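(* The alternating group $A_n$ is minimal wexp-nonsolvable if and only if $n \ge 7$.
   Context: Let $G$ be a finite group. A subgroup $H \le G$ is called weakly exponential with respect to $G$ if, for all $x \in G$, there exists $g \in G$ such that $x^{|G:H|} \in H^g$, where $H^g = g^{-1}Hg$. The group $G$ is called wexp-solvable if every subgroup of $G$ is weakly exponential with respect to $G$, and wexp-nonsolvable if it is not wexp-solvable. The group $G$ is called minimal wexp-nonsolvable if $G$ is wexp-nonsolvable but all proper quotients of $G$ (quotients by nontrivial normal subgroups) are wexp-solvable. *)

(* Defs.v *)
From mathcomp Require Import all_boot all_fingroup all_solvable.

Set Implicit Arguments.
Unset Strict Implicit.
Unset Printing Implicit Defensive.

Local Open Scope group_scope.

Definition weakly_exponential (gT : finGroupType) (G H : {group gT}) : Prop :=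
  forall x, x \in G -> exists2 g, g \in G & x ^+ #|G : H| \in H :^ g.

Definition wexp_solvable (gT : finGroupType) (G : {group gT}) : Prop :=
  forall H : {group gT}, H \subset G -> weakly_exponential G H.

Definition wexp_nonsolvable (gT : finGroupType) (G : {group gT}) : Prop :=
  ~ wexp_solvable G.

Definition minimal_wexp_nonsolvable (gT : finGroupType) (G : {group gT}) :
    Prop :=
  wexp_nonsolvable G /\
  forall N : {group gT}, N <| G -> N :!=: 1 -> wexp_solvable (G / N)%G.

(* Main.v *)
Require Import Defs.
From mathcomp Require Import all_boot all_fingroup all_solvable.

(** For [n >= 7] the obstruction is a point stabiliser, tested on an even
    permutation [x] without fixed points whose order is coprime to [n].  Such
    an [x] exists: cycles of lengths 2, 2 and [n - 4] when [n]
    is odd; two cycles of odd lengths [n/2 - c] and [n/2 + c], with [c] equal to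
    1 or 2, when [n] is even ([exists_fpf_even_coprime]).  A point stabiliser
    [H] has index [n], and [x] is a power of [x ^+ n]; so if [x ^+ n] lay in a
    conjugate of [H], which is again a point stabiliser, [x] would fix a point
    ([Alt_wexp_nonsolvable]).  Simplicity of the alternating group leaves only
    the trivial proper quotient, so minimality is automatic.

    For [n <= 6] every even permutation has order dividing the square of a
    prime, as a parity count over the possible cycle types shows
    ([even_perm_prime_square]).  Sylow theory then gives wexp-solvability
    ([wexp_solvable_prime_square]): the only case in which the index of [H]
    does not either kill [x] or leave a full Sylow subgroup in [H] is the one
    where a Sylow subgroup of [H] has index [p] in one of [G]; it is then
    normal there, and contains all [p]-th powers.  In degree 6 this settles
    the elements of order 4. *)

Local Open Scope group_scope.

(** * Groups whose elements have order dividing the square of a prime *)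

Lemma expg_index_normal (gT : finGroupType) (P Q : {group gT}) (z : gT) :
  Q <| P -> z \in P -> z ^+ #|P : Q| \in Q.
Proof.
move=> nsQP Pz; have nQz : z \in 'N(Q) := subsetP (normal_norm nsQP) z Pz.
rewrite coset_idr ?groupX // morphX // -card_quotient ?normal_norm //.
by apply: expg_cardG; rewrite mem_quotient.
Qed.

(** Write [m] for the index of [H].  If [p ^ 2] divides [m], then
    [x ^+ m = 1].  Otherwise a Sylow [p]-subgroup [Q] of [H] has index 1 or [p]
    in a Sylow [p]-subgroup [P] of [G], hence is normal in [P], while [x] has a
    conjugate in [P]; raising it to the power [#|P : Q|], a divisor of [m],
    brings it into [Q]. *)
Lemma wexp_solvable_prime_square (gT : finGroupType) (G : {group gT}) :
  (forall x, x \in G -> exists2 p, prime p & x ^+ (p ^ 2) = 1) ->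
  wexp_solvable G.
Proof.
move=> expG H sHG x Gx; have [p p_pr xp2] := expG x Gx.
set m := #|G : H|.
have [p2m | p2m] := boolP (p ^ 2 %| m)%N.
  exists 1 => //; rewrite conjsg1.
  by case/dvdnP: p2m => k ->; rewrite mulnC expgM xp2 expg1n group1.
have p_x : p.-group <[x]>.
  rewrite /pgroup -[#|_|]/(#[x]).
  have /pnat_dvd : #[x] %| p ^ 2 by rewrite order_dvdn xp2.
  by apply; rewrite pnatX pnat_id.
have [Q sylQ] := Sylow_exists p H.
have [sQH pQ _] := and3P sylQ.
have [P sylP sQP] := Sylow_superset (subset_trans sQH sHG) pQ.
have [_ pP _] := and3P sylP.
have [g Gg sxgP] : exists2 g, g \in G & <[x]> :^ g \subset P.
  by apply: Sylow_Jsub sylP _ p_x; rewrite cycle_subG.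
have Pxg : x ^ g \in P by rewrite (subsetP sxgP) // memJ_conjg cycle_id.
have indQ : #|P : Q| = (m`_p)%N.
  apply/eqP; rewrite -(eqn_pmul2l (cardG_gt0 Q)) Lagrange //.
  by rewrite (card_Hall sylP) (card_Hall sylQ) -(Lagrange sHG) partnM.
have nsQP : Q <| P.
  have [k def_k] : exists k, (m`_p = p ^ k)%N by rewrite p_part; eexists.
  have k_lt2 : k < 2.
    rewrite ltnNge; apply: contra p2m => le2k.
    by rewrite (dvdn_trans _ (dvdn_part p m)) // def_k dvdn_exp2l.
  case: k k_lt2 def_k => [|[|k]] // _ def_k.
    by rewrite (index1g sQP (etrans indQ def_k)) normal_refl.
  apply: (p_maximal_normal pP); apply: (p_index_maximal sQP).
  by rewrite indQ def_k expn1.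
exists g^-1; first by rewrite groupV.
rewrite mem_conjgV conjXg (subsetP sQH) //.
have /dvdnP[k ->] : #|P : Q| %| m by rewrite indQ dvdn_part.
by rewrite mulnC expgM groupX // expg_index_normal.
Qed.

(** * Even permutations of at most six points *)

(** The cycle types of even permutations of at most 6 points.  A partition
    with parts divisible by two different primes would need a part 6 or
    parts 2 and 3, and in total size at most 6 these are the types of odd
    permutations; a prime power at most 6 divides the square of its prime.  The
    sum plus the number of parts is the parity of a permutation with that
    cycle type. *)
Lemma small_even_partition (s : seq nat) :
    all (leq 1) s -> sumn s <= 6 -> ~~ odd (sumn s + size s) ->
  exists2 p, prime p & all (fun k => k %| p ^ 2) s.
Proof.
move=> s_gt0 s_le6 s_even.
suff /hasP[p _ /andP[p_pr sp]] :
    has (fun p => prime p && all (fun k => k %| p ^ 2) s) [:: 2; 3; 5].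
  by exists p.
(* Split off parts one at a time, each at most 6; seven nonzero parts are
   already too many. *)
move: s s_gt0 s_le6 s_even.
by do 7?[case=> [//|[|[|[|[|[|[|[|a]]]]]]]] //].
Qed.

Lemma sum_card_porbits {T : finType} (x : {perm T}) :
  \sum_(A in porbits x) #|A| = #|T|.
Proof.
rewrite -[RHS]cardsT; apply/esym/card_partition.
have -> : porbits x = [set orbit 'P <[x]> y | y in [set: T]].
  by apply/setP=> A; apply/imsetP/imsetP=> -[y _ ->]; exists y;
    rewrite ?inE ?porbitE.
by apply: orbit_partition; apply/actsP=> a _ y; rewrite !inE.
Qed.

Lemma even_perm_prime_square {T : finType} (x : {perm T}) :
  #|T| <= 6 -> ~~ odd_perm x -> exists2 p, prime p & x ^+ (p ^ 2) = 1.
Proof.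
move=> T_le6 even_x; pose s := [seq #|pred_of_set A| | A in porbits x].
have sum_s : sumn s = #|T|.
  by rewrite sumnE big_map big_enum sum_card_porbits.
have size_s : size s = #|porbits x| by rewrite size_image.
have [||| p p_pr /allP sp] := @small_even_partition s.
- apply/allP=> k /imageP[A /imsetP[y _ ->] ->].
  by rewrite lt0n card_porbit_neq0.
- by rewrite sum_s.
- by rewrite oddD sum_s size_s.
exists p => //; apply/permP=> y; rewrite perm1 permX.
have /dvdnP[k ->] : #|porbit x y| %| p ^ 2.
  by apply/sp/imageP; exists (porbit x y); rewrite ?imset_f.
by rewrite -permX mulnC expgM; elim: k => [|k IHk];
  rewrite ?expg0 ?perm1 // expgSr permM IHk permX iter_porbit.
Qed.

(** * Point stabilisers and fixed-point-free permutations *)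

(** A point stabiliser is the witness: its index is the degree, so by
    coprimality [x] is a power of [x ^+ #|T|], and a conjugate of the
    stabiliser containing the latter would give [x] a fixed point. *)
Lemma Alt_wexp_nonsolvable {T : finType} (x : {perm T}) :
    2 < #|T| -> ~~ odd_perm x -> (forall t, x t != t) ->
    coprime #[x] #|T| ->
  wexp_nonsolvable 'Alt_T.
Proof.
move=> T_gt2 even_x fpf_x co_x wexpT.
have /card_gt0P[t _] : 0 < #|T| by apply: leq_trans T_gt2.
pose H := 'C_('Alt_T)[t | 'P]%G.
have indH : #|'Alt_T : H| = #|T|.
  rewrite -card_orbit -[RHS]cardsT; congr #|pred_of_set _|.
  have trT : [transitive 'Alt_T, on [set: T] | 'P].
    by apply: ntransitive1 (Alt_trans T); rewrite -subn2 subn_gt0.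
  exact: (atransP trT).
have sHA : H \subset 'Alt_T by apply: subsetIl.
have [|g _] := wexpT H sHA x; first by rewrite Alt_even.
rewrite indH mem_conjg => /setIP[_ /astab1P /= fix_t].
(* [g] conjugates the stabiliser of [t] into that of [g t]. *)
set y := x ^+ _ in fix_t.
have yfix : y (g t) = g t.
  by move: fix_t; rewrite /aperm conjgE invgK !permM => /(canRL (permKV g)).
have x_y : x \in <[y]>.
  by rewrite -(expgK (G := <[x]>) co_x (cycle_id x)) mem_cycle.
have sub_y : <[y]> \subset 'C[g t | 'P] by rewrite cycle_subG; apply/astab1P.
by case/eqP: (fpf_x (g t)); move/(subsetP sub_y)/astab1P: x_y.
Qed.

Definition moved {T : finType} (p : {perm T}) : {set T} := [set t | p t != t].

Lemma odd_permX {T : finType} (p : {perm T}) k :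
  odd_perm (p ^+ k) = odd k && odd_perm p.
Proof.
elim: k => [|k IHk]; first by rewrite expg0 odd_perm1.
by rewrite expgS odd_permM IHk /=; case: (odd k); case: odd_perm.
Qed.

Lemma perm_on_moved {T : finType} (p : {perm T}) : perm_on (moved p) p.
Proof. by apply/subsetP=> t; rewrite !inE. Qed.

Lemma moved_mul {T : finType} (p q : {perm T}) :
  [disjoint moved p & moved q] -> moved (p * q) = moved p :|: moved q.
Proof.
move=> dis; apply/setP=> t; rewrite !inE permM.
have [pt | pt] := eqVneq (p t) t; first by rewrite pt.
have /(disjointFr dis) : p t \in moved p by rewrite inE (inj_eq perm_inj).
by rewrite inE => /eqP->; rewrite pt.
Qed.

(** [next s] is the cyclic successor in [s], and the identity off [s]. *)
Lemma exists_cycle {T : finType} (s : seq T) :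
    uniq s -> 1 < size s ->
  exists2 p : {perm T}, moved p = [set t in s] & p ^+ size s = 1.
Proof.
move=> Us s_gt1; pose p := perm (can_inj (prev_next Us)).
have p_out t : t \notin s -> p t = t.
  by move=> s't; rewrite permE next_nth (negPf s't).
exists p; [apply/setP => t | apply/permP => t].
- rewrite !inE; have [s_t | /p_out->] := boolP (t \in s); last by rewrite eqxx.
  rewrite permE; case: (rot_to s_t) => i s' def_s; rewrite -(next_rot i Us).
  move: (Us) s_gt1; rewrite -(rot_uniq i) -(size_rot i) def_s.
  case: s' {def_s} => [|u s'] //= /andP[+ _] _.
  by rewrite inE negb_or eqxx eq_sym => /andP[].
rewrite perm1 permX; have [s_t | s't] := boolP (t \in s).
  rewrite -(order_cycle (cycle_next Us) Us s_t).
  rewrite (eq_iter (permE _)).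
  by rewrite fingraph.iter_order //; apply: can_inj (prev_next Us).
by elim: (size s) => //= k ->; apply: p_out.
Qed.

(** A permutation [p] is completed to a fixed-point-free one by a single cycle
    through all the points that [p] fixes; its odd length makes that cycle
    even, and the order of the product divides [#[p]] times that length. *)
Lemma exists_complement_cycle {T : finType} (p : {perm T}) :
    ~~ odd_perm p -> coprime #[p] #|T| -> 1 < #|~: moved p| ->
    odd #|~: moved p| -> coprime #|~: moved p| #|T| ->
  exists x : {perm T},
    [/\ ~~ odd_perm x, forall t, x t != t & coprime #[x] #|T|].
Proof.
set B := ~: moved p => even_p co_p B_gt1 odd_B co_B.
have [||q mq qB] := @exists_cycle _ (enum B); rewrite ?enum_uniq -?cardE //.
rewrite -cardE in qB; have {}mq : moved q = B.
  by apply/setP=> t; rewrite mq !inE mem_enum !inE.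
have dis : [disjoint moved p & moved q] by rewrite mq disjoints_subset setCK.
have cpq : commute p q by apply: perm_onC (perm_on_moved p) (perm_on_moved q) dis.
have even_q : ~~ odd_perm q.
  by have := odd_permX q #|B|; rewrite qB odd_perm1 odd_B => /= <-.
exists (p * q); split=> [|t|].
- by rewrite odd_permM (negPf even_p).
- suff : t \in moved (p * q) by rewrite inE.
  by rewrite moved_mul // mq setUCr inE.
apply: (@coprime_dvdl _ (#[p] * #|B|)); last by rewrite coprimeMl co_p.
rewrite order_dvdn expgMn // expgM expg_order expg1n mulnC expgM qB expg1n.
by rewrite mulg1.
Qed.

(** Halving: [n = 2 k] is split as [(k - c) + (k + c)], where [c], equal to 1
    or 2, is chosen to make [k - c] odd.  The two parts are odd and differ by
    [2 c], a power of 2, so they are coprime to each other and therefore to their sum. *)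
Lemma exists_odd_coprime_split n :
    6 < n -> ~~ odd n ->
  exists a, [/\ 1 < a, a.+1 < n, odd a, coprime a n & coprime (n - a) n].
Proof.
move=> n_gt6 even_n; have [k def_n] : exists k, n = (k + k)%N.
  by exists n./2; rewrite addnn even_halfK.
have k_gt3 : 3 < k by move: n_gt6; rewrite def_n; case: (k) => [|[|[|[|]]]].
have split_at c : 0 < c -> c.+1 < k -> odd (k - c) -> coprime (k - c) (c + c) ->
    exists a, [/\ 1 < a, a.+1 < n, odd a, coprime a n & coprime (n - a) n].
  move=> c_gt0 c_lt odd_a co_a; exists (k - c).
  have le_ck : c <= k by rewrite ltnW // ltnW.
  have le_an : k - c <= n by rewrite def_n (leq_trans (leq_subr _ _)) ?leq_addr.
  have co_n : coprime (k - c) n.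
    rewrite def_n -{2 3}(subnK le_ck) addnACA /coprime.
    by rewrite -addnA !gcdnDl.
  split=> //.
  - by rewrite ltn_subRL addn1.
  - rewrite -addn1 def_n; apply: leq_ltn_trans (_ : k + 1 < _).
      by rewrite leq_add2r leq_subr.
    by rewrite ltn_add2l (leq_trans _ k_gt3).
  by rewrite /coprime -{2}(subnK le_an) gcdnDl gcdnC -gcdnDr subnK.
have [odd_k | even_k] := boolP (odd k).
  have k_gt4 : 4 < k.
    by rewrite ltn_neqAle k_gt3 andbT; apply: contraTneq odd_k => <-.
  have odd_k2 : odd (k - 2) by rewrite oddB ?odd_k // ltnW // ltnW.
  by apply: (split_at 2) => //; apply: (@coprimeXr 2 _ 2); rewrite coprimen2.
have odd_k1 : odd (k - 1).
  by rewrite oddB ?(negPf even_k) // ltnW // ltnW // ltnW.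
by apply: (split_at 1%N); rewrite ?coprimen2 // ltnW.
Qed.

(** In odd degree the parity rules out two cycles, whence the types
    [(2, 2, #|T| - 4)]; in even degree two odd cycles suffice.  The bound 6 is
    sharp: degree 6 has only the split [5 + 1], which leaves a fixed point. *)
Lemma exists_fpf_even_coprime {T : finType} :
    6 < #|T| ->
  exists x : {perm T},
    [/\ ~~ odd_perm x, forall t, x t != t & coprime #[x] #|T|].
Proof.
move=> T_gt6; have [odd_n | even_n] := boolP (odd #|T|).
  have [s [Us sz_s]] : exists s : seq T, uniq s /\ size s = 4.
    exists (take 4 (enum T)); rewrite take_uniq ?enum_uniq // size_takel //.
    by rewrite -cardE (leq_trans _ T_gt6).
  case: s Us sz_s => [|a [|b [|c [|d [|//]]]]] //= Us _.
  move: Us; rewrite !inE !negb_or -!andbA.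
  case/and5P=> ab ac ad bc /and3P[bd cd _].
  have mt (u v : T) : u != v -> moved (tperm u v) = [set u; v].
    move=> uv; apply/setP=> t; rewrite !inE.
    by case: tpermP => [->|->|/eqP/negPf-> /eqP/negPf->];
      rewrite ?eqxx ?uv ?orbT // eq_sym uv.
  have dis : [disjoint moved (tperm a b) & moved (tperm c d)].
    rewrite !mt // disjoints_subset; apply/subsetP=> t; rewrite !inE.
    by case/orP=> /eqP->; rewrite negb_or ?ac ?ad ?bc ?bd.
  pose p := tperm a b * tperm c d.
  have cB : #|~: moved p| = #|T| - 4.
    rewrite cardsCs setCK moved_mul // cardsU.
    rewrite (eqP (_ : _ :&: _ == set0)) ?setI_eq0 //.
    by rewrite cards0 subn0 !mt // !cards2 ab cd.
  apply: (@exists_complement_cycle _ p); rewrite ?cB.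
  - by rewrite odd_permM !odd_tperm ab cd.
  - apply: (@coprime_dvdl _ 2); last by rewrite coprime2n.
    have ct := perm_onC (perm_on_moved _) (perm_on_moved _) dis.
    by rewrite order_dvdn expgMn // !expgS !expg0 !mulg1 !tperm2 mulg1.
  - by rewrite ltn_subRL (leq_trans _ T_gt6).
  - by rewrite oddB ?odd_n // (leq_trans _ T_gt6).
  have T4 : 4 <= #|T| by apply: leq_trans T_gt6.
  rewrite /coprime -{2}(subnK T4) gcdnDl -/(coprime _ (2 ^ 2)).
  by rewrite coprimeXr // coprimen2 oddB // odd_n.
have [a [a_gt1 a_lt odd_a co_a co_b]] := exists_odd_coprime_split _ T_gt6 even_n.
have le_a : a <= #|T| by rewrite ltnW // ltnW.
have sz_a : size (take a (enum T)) = a by rewrite size_takel // -cardE.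
have Ua : uniq (take a (enum T)) by rewrite take_uniq ?enum_uniq.
have [|p mp pa] := exists_cycle _ Ua; first by rewrite sz_a.
rewrite sz_a in pa.
have cB : #|~: moved p| = #|T| - a.
  by rewrite cardsCs setCK mp cardsE (card_uniqP Ua) sz_a.
apply: (@exists_complement_cycle _ p); rewrite ?cB //.
- by have := odd_permX p a; rewrite pa odd_perm1 odd_a => /= <-.
- by apply: coprime_dvdl co_a; rewrite order_dvdn pa.
- by rewrite ltn_subRL addn1.
by rewrite oddB // odd_a addbT.
Qed.

(** * The classification *)

Theorem theorem1p11 (n : nat) :
  minimal_wexp_nonsolvable ('Alt_('I_n))%G <-> (7 <= n)%N.
Proof.
split=> [[nonsolv _] | n_ge7].
  rewrite leqNgt; apply/negP=> n_lt7; apply: nonsolv.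
  apply: wexp_solvable_prime_square => x; rewrite Alt_even.
  by apply: even_perm_prime_square; rewrite card_ord.
have [x [even_x fpf_x co_x]] : exists x : {perm 'I_n},
    [/\ ~~ odd_perm x, forall t, x t != t & coprime #[x] #|'I_n|].
  by apply: exists_fpf_even_coprime; rewrite card_ord.
split=> [|N nsN ntN].
  apply: Alt_wexp_nonsolvable even_x fpf_x co_x.
  by rewrite card_ord (leq_trans _ n_ge7).
have /simpleP[_ simA] : simple 'Alt_('I_n).
  by apply: simple_Alt5; rewrite card_ord (leq_trans _ n_ge7).
case: (simA N nsN) => [N1 | ->]; first by rewrite N1 eqxx in ntN.
apply: wexp_solvable_prime_square => x' /=; rewrite trivg_quotient => /set1P->.
by exists 2; rewrite ?expg1n.
Qed.
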